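(* Let $\mathbb F$ be an algebraically closed field of characteristic $0$, let $n\ge 1$, and let $k \geq 2$ be an integer. For $A_1 \in \mathrm{GL}_n(\mathbb F)$ and $A_2 \in M_n(\mathbb F)$, consider the map $\omega : M_n(\mathbb F) \times M_n(\mathbb F) \rightarrow M_n(\mathbb F)$ given by $$\omega(x_1, x_2) = A_1 x_1^k + A_2 x_2^k.$$ Let $r_0=\dim\ker(A_2)$ be the nullity of $A_2$. Then: (1) If $r_0 \leq 1$, then $\omega$ is surjective on $M_n(\mathbb F)$. (2) If $n \leq k(r_0 - 1)$, then $\omega$ is not surjective on $M_n(\mathbb F)$.
   Context: $M_n(\mathbb F)$ denotes the algebra of $n\times n$ matrices over $\mathbb F$, and $\mathrm{GL}_n(\mathbb F)$ the group of invertible ones. *)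

(* Defs.v *)
From mathcomp Require Import all_boot all_order all_algebra.
Set Implicit Arguments.
Unset Strict Implicit.
Unset Printing Implicit Defensive.
Import GRing.Theory.
Local Open Scope ring_scope.

(* MathComp's [kermx] is the kernel for the action on row vectors; the columns
   of [cokermx A] span the column vectors [v] with [A *m v = 0]. *)
Definition nullity (F : fieldType) (n : nat) (A : 'M[F]_n) : nat :=
  \rank (cokermx A).

Definition omega (F : fieldType) (n k : nat) (A1 A2 : 'M[F]_n)
    (x : 'M[F]_n * 'M[F]_n) : 'M[F]_n :=
  A1 * x.1 ^+ k + A2 * x.2 ^+ k.

Definition surjective (T U : Type) (f : T -> U) : Prop :=
  forall y : U, exists x : T, f x = y.

(* Main.v *)
Require Import Defs.
From mathcomp Require Import all_boot all_order all_algebra.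
From mathcomp Require Import zify.
Import GRing.Theory.
Local Open Scope ring_scope.

Lemma closed_field_root (F : closedFieldType) (k : nat) (a : F) :
  (0 < k)%N -> exists b : F, b ^+ k = a.
Proof.
move=> k_gt0; have /closed_rootP[b] : size ('X^k - a%:P : {poly F}) != 1%N.
  by rewrite size_XnsubC // eqSS -lt0n.
by rewrite /root !hornerE subr_eq0 => /eqP bk; exists b.
Qed.

Lemma closed_field_nonroot (F : closedFieldType) (p : {poly F}) :
  p != 0 -> exists c : F, p.[c] != 0.
Proof.
move=> p_neq0; have [/eqP/size_poly1P[a a_neq0 ->]|p_size] := eqVneq (size p) 1%N.
  by exists 0; rewrite hornerC.
have /closed_rootP[c] : size (p - 1) != 1%N.
  have p_gt1 : (1 < size p)%N.
    by rewrite ltn_neqAle eq_sym p_size lt0n size_poly_eq0.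
  by rewrite size_polyDl // size_polyN size_poly1.
rewrite /root !hornerE subr_eq0 => /eqP pc1.
by exists c; rewrite pc1 oner_neq0.
Qed.

(* Hensel lifting one linear factor at a time: if [p] divides [f ^+ k - 'X],
   some [f + t *: p] with [t] constant works for [p * ('X - a%:P)]. When
   [p.[a] = 0], the choice of [t] solves a linear equation with leading
   coefficient [k f(a)^(k-1)], which is where characteristic 0 is used. *)
Lemma kth_root_mod_prod (F : closedFieldType) (k : nat) (s : seq F) :
  [pchar F] =i pred0 -> (0 < k)%N -> 0 \notin s ->
  exists f : {poly F}, \prod_(a <- s) ('X - a%:P) %| f ^+ k - 'X.
Proof.
move=> char0 k_gt0; elim: s => [|a s IHs].
  by exists 0; rewrite big_nil dvd1p.
rewrite inE negb_or eq_sym => /andP[a_neq0 /IHs[f]].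
rewrite big_cons; set p := \prod_(_ <- s) _ => /dvdpP[h fkE].
pose g t := f + t *: p.
(* The cofactor of [p] in [g t ^+ k - 'X]: the difference [g t ^+ k - f ^+ k] factors with [t *: p]
   as one factor. *)
pose h' t := h + t *: \sum_(i < k) g t ^+ (k.-1 - i) * f ^+ i.
have gkE t : g t ^+ k - 'X = p * h' t.
  rewrite -(subrKA (f ^+ k)) subrXX fkE /g addrAC subrr add0r -/(g t) addrC.
  by rewrite mulrDr -scalerAl scalerAr mulrC.
suff [t h't] : exists t, root (h' t) a.
  by exists (g t); rewrite gkE mulrC dvdp_mul // dvdp_XsubCl.
have [pa0|pa_neq0] := eqVneq p.[a] 0.
  have fa : f.[a] ^+ k = a.
    apply/eqP; rewrite -subr_eq0; move/(congr1 (horner^~ a)): fkE.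
    by rewrite !hornerE pa0 mulr0 => ->.
  have d_neq0 : k%:R * f.[a] ^+ k.-1 != 0.
    rewrite mulf_neq0 //.
      by have /pcharf0P -> := char0; rewrite -lt0n.
    rewrite expf_neq0 //; apply: contraNneq a_neq0 => fa0.
    by rewrite -fa fa0 expr0n -(prednK k_gt0).
  exists (- h.[a] / (k%:R * f.[a] ^+ k.-1)).
  rewrite /root !hornerE horner_sum (eq_bigr (fun=> f.[a] ^+ k.-1)) => [|i _].
    by rewrite sumr_const card_ord -[f.[a] ^+ _ *+ k]mulr_natl divfK // subrr.
  rewrite !hornerE pa0 mulr0 addr0 -exprD subnK //.
  by rewrite -ltnS (prednK k_gt0).
(* Now [p.[a]] is nonzero, so [t] can be chosen by interpolation to give [g t] the value [b] at [a];
   then [p * h' t] vanishes at [a], hence so does [h' t]. *)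
have [b bk] := @closed_field_root F k a k_gt0.
exists ((b - f.[a]) / p.[a]); set t := _ / _.
have gta : (g t).[a] = b by rewrite !hornerE divfK // addrC subrK.
move/(congr1 (horner^~ a)): (gkE t).
rewrite hornerM hornerD hornerN horner_exp gta hornerX bk subrr => /esym/eqP.
by rewrite mulf_eq0 (negPf pa_neq0).
Qed.

(** The eigenvalues of [A] are nonzero, so ['X] is a [k]-th power [f ^+ k] modulo the characteristic
    polynomial; Cayley-Hamilton turns this into an identity at [A]. *)
Lemma unitmx_kth_root (F : closedFieldType) (n k : nat) (A : 'M[F]_n.+1) :
  [pchar F] =i pred0 -> (0 < k)%N -> A \in unitmx ->
  exists X : 'M[F]_n.+1, X ^+ k = A.
Proof.
move=> char0 k_gt0 A_unit.
have [s] := closed_field_poly_normal (char_poly A).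
rewrite (monicP (char_poly_monic A)) scale1r => charA.
have s_neq0 : 0 \notin s.
  rewrite -root_prod_XsubC -charA /root horner_coef0 char_poly_det.
  by rewrite mulf_eq0 signr_eq0 -unitfE -unitmxE A_unit.
have [f /dvdpP[h]] := @kth_root_mod_prod F k s char0 k_gt0 s_neq0.
rewrite -charA => /(congr1 (horner_mx A)).
rewrite rmorphB rmorphXn /= rmorphM /= Cayley_Hamilton mulr0 horner_mx_X.
by move/eqP; rewrite subr_eq0 => /eqP fA; exists (horner_mx A f).
Qed.

Lemma expr_idempotent_comb (F : fieldType) (R : algType F) (e : R) (x y : F) (k : nat) :
  e * e = e -> (x *: (1 - e) + y *: e) ^+ k = x ^+ k *: (1 - e) + y ^+ k *: e.
Proof.
move=> ee; elim: k => [|k IHk]; first by rewrite !expr0 !scale1r subrK.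
have e1e : (1 - e) * e = 0 by rewrite mulrBl mul1r ee subrr.
have ee1 : e * (1 - e) = 0 by rewrite mulrBr mulr1 ee subrr.
have e1e1 : (1 - e) * (1 - e) = 1 - e by rewrite mulrBr mulr1 e1e subr0.
rewrite exprS IHk mulrDl !mulrDr -!scalerAl -!scalerAr.
by rewrite e1e ee1 ee e1e1 !scaler0 addr0 add0r !scalerA !exprS.
Qed.

(** In rank one, [Q] is a column [u] times a row [v], and [v Y u] is a scalar. *)
Lemma rank_le1_sandwich (F : fieldType) (n : nat) (Q Y : 'M[F]_n) :
  (\rank Q <= 1)%N -> exists a : F, Q *m Y *m Q = a *: Q.
Proof.
move: (\rank Q) (col_base Q) (row_base Q) (mulmx_base Q) => [|[|//]] u v <- _.
  by exists 0; rewrite [u]thinmx0 !mul0mx scaler0.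
exists ((v *m Y *m u) 0 0).
have -> : u *m v *m Y *m (u *m v) = u *m (v *m Y *m u) *m v by rewrite !mulmxA.
by rewrite {1}[v *m Y *m u]mx11_scalar mul_mx_scalar -scalemxAl.
Qed.

(* Take [X ^+ k = c + Q (Y - c)] with [c] generic: then
   [Y - X ^+ k = (1 - Q) (Y - c) = B S^-1 (Y - c)] and [S^-1 (Y - c)] is
   invertible. As [(Q (Y - c))^2] is a multiple of [Q (Y - c)], the required
   [X] is a combination of two complementary idempotents. *)
Lemma solvable_of_factorization (F : closedFieldType) (n k : nat)
    (Q S Y : 'M[F]_n.+1) :
  [pchar F] =i pred0 -> (0 < k)%N -> S \in unitmx -> Q * Q = Q ->
  (\rank Q <= 1)%N ->
  exists X Z : 'M[F]_n.+1, X ^+ k + (1 - Q) * S * Z ^+ k = Y.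
Proof.
move=> char0 k_gt0 S_unit QQ /(@rank_le1_sandwich _ _ _ Y)[a]; rewrite !mulmxE => QYQ.
(* Avoiding the eigenvalues of [Y] makes [Y - c] invertible; avoiding [a] lets [Q (Y - c)] be
   rescaled to an idempotent. *)
have [c] : exists c : F, (char_poly Y * ('X - a%:P)).[c] != 0.
  apply: closed_field_nonroot.
  by rewrite mulf_neq0 ?polyXsubC_eq0 // monic_neq0 ?char_poly_monic.
rewrite hornerM !hornerE mulf_eq0 negb_or => /andP[charY_c a_neq_c].
have Yc_unit : Y - c%:A \in unitmx.
  rewrite scalemx1 -row_free_unit -kermx_eq0.
  move: charY_c; rewrite -[_ != 0]/(~~ root _ _) -eigenvalue_root_char.
  by rewrite /eigenvalue /eigenspace negbK.
have [Z Zk] : exists Z : 'M[F]_n.+1, Z ^+ k = invmx S * (Y - c%:A).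
  apply: unitmx_kth_root => //.
  by rewrite -[_ * _]/(_ *m _) unitmx_mul unitmx_inv S_unit.
have [x xk] := @closed_field_root F k c k_gt0.
have [y yk] := @closed_field_root F k a k_gt0.
have ac_neq0 : a - c != 0 by rewrite -opprB oppr_eq0.
pose e := (a - c)^-1 *: (Q * (Y - c%:A)).
have QYcQ : Q * (Y - c%:A) * Q = (a - c) *: Q.
  by rewrite mulrBr mulrBl QYQ -scalerAr mulr1 -scalerAl QQ scalerBl.
have ee : e * e = e.
  rewrite /e -scalerAl -scalerAr mulrA QYcQ -scalerAl.
  by congr (_ *: _); rewrite scalerA mulVf // scale1r.
exists (x *: (1 - e) + y *: e), Z.
rewrite expr_idempotent_comb // xk yk Zk.
have -> : (1 - Q) * S * (invmx S * (Y - c%:A)) = (1 - Q) * (Y - c%:A).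
  rewrite -!mulrA; congr (_ * _); rewrite !mulrA.
  by rewrite -[S * invmx S]/(S *m invmx S) mulmxV // mul1r.
have -> : c *: (1 - e) + a *: e = c%:A + Q * (Y - c%:A).
  by rewrite scalerBr addrAC -addrA -scalerBl /e scalerA divff // scale1r.
by rewrite mulrBl mul1r -addrA [Q * _ + _]addrC subrK addrC subrK.
Qed.

Lemma solvable_of_corank_le1 (F : closedFieldType) (n k : nat)
    (B Y : 'M[F]_n.+1) :
  [pchar F] =i pred0 -> (0 < k)%N -> (n <= \rank B)%N ->
  exists X Z : 'M[F]_n.+1, X ^+ k + B * Z ^+ k = Y.
Proof.
move=> char0 k_gt0 n_le_r.
have L_unit := col_ebase_unit B; have R_unit := row_ebase_unit B.
set L := col_ebase B in L_unit; set R := row_ebase B in R_unit.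
pose C : 'M[F]_n.+1 := copid_mx (\rank B).
(* [1 - C] is the diagonal projection in [B = L (1 - C) R], so [Q = L C L^-1] is idempotent of rank
   [n.+1 - \rank B], at most one. *)
have BE : B = (1 - L * C * L^-1) * (L * R).
  rewrite -[LHS]mulmx_ebase -/L -/R mulrBl mul1r !mulrA mulrVK //.
  by rewrite -mulrBl -{2}[L]mulr1 -mulrBr /C /copid_mx opprB addrC subrK.
rewrite BE; apply: solvable_of_factorization => //.
- by rewrite -[_ * _]/(_ *m _) unitmx_mul L_unit.
- by rewrite !mulrA mulrVK // -[_ * C * C]mulrA [C * C]copid_mx_id ?rank_leq_row.
apply: leq_trans (mxrankM_maxl _ _) _; apply: leq_trans (mxrankM_maxr _ _) _.
by rewrite rank_copid_mx ?rank_leq_row // leq_subLR addn1.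
Qed.

(** The polynomials [q] with [v q(X) = 0] form an ideal containing ['X^(m + j)] and the
    characteristic polynomial, hence their gcd. Up to a scalar this is ['X^i] with [i <= n.+1], so
    [m >= n.+1] would force [v X^m = 0]. *)
Lemma mulmx_exp_eq0_order_lt (F : fieldType) (n m j : nat) (X : 'M[F]_n.+1)
    (v : 'rV[F]_n.+1) :
  v *m X ^+ m != 0 -> v *m X ^+ (m + j) = 0 -> (m < n.+1)%N.
Proof.
move=> vXm_neq0 vXmj; rewrite ltnNge; apply: contra_neqN vXm_neq0 => n_le_m.
have [[u w] /= Bezout] := Bezoutp 'X^(m + j) (char_poly X).
have /dvdp_exp_XsubCP : gcdp 'X^(m + j) (char_poly X) %| ('X - 0%:P) ^+ (m + j).
  by rewrite subr0 dvdp_gcdl.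
rewrite subr0 => -[i _ gcdE].
have i_le_m : (i <= m)%N.
  apply: leq_trans n_le_m; rewrite -ltnS -(size_polyXn F) -(eqp_size gcdE).
  rewrite -(size_char_poly X) dvdp_leq ?dvdp_gcdr //.
  by rewrite monic_neq0 ?char_poly_monic.
have /eqpP[[c d] /= /andP[_ d_neq0]] := eqp_trans Bezout gcdE.
move/(congr1 (horner_mx X)).
rewrite !linearZ /= rmorphD !rmorphM /= Cayley_Hamilton mulr0 addr0.
rewrite !rmorphXn /= horner_mx_X.
rewrite [X in c *: X](_ : _ = X ^+ (m + j) * horner_mx X u); last first.
  by rewrite -[X in X ^+ _](horner_mx_X X) -!rmorphXn -!rmorphM mulrC.
move/(congr1 (mulmx v)); rewrite -!scalemxAr mulmxA vXmj mul0mx scaler0.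
move/esym/eqP; rewrite scaler_eq0 (negPf d_neq0) /= => /eqP vXi.
by rewrite -(subnKC i_le_m) exprD mulmxA vXi mul0mx.
Qed.

(* With [B = L pid_mx(rank B) R], aim at [Y = L N L^-1], [N] the nilpotent shift.
   The last [n.+1 - \rank B] rows of [L^-1 B] vanish, so on the corresponding
   vectors [e_i L^-1] the matrix [X ^+ k] acts as a shift, which makes [X]
   nilpotent of order above [n.+1] on the first of them. *)
Lemma unsolvable_of_large_corank (F : fieldType) (n k : nat) (B : 'M[F]_n.+1) :
  (n < k * (n - \rank B))%N ->
  exists Y : 'M[F]_n.+1, forall X Z : 'M[F]_n.+1, X ^+ k + B * Z ^+ k <> Y.
Proof.
move=> n_lt; set r := \rank B in n_lt.
have r_le_n : (r <= n)%N.
  rewrite leqNgt; apply: contraTN n_lt => /ltnW.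
  by rewrite -subn_eq0 => /eqP->; rewrite muln0.
have L_unit := col_ebase_unit B; set L := col_ebase B in L_unit.
pose N : 'M[F]_n.+1 := \matrix_(i, j) (j == i.+1 :> nat)%:R.
exists (L *m N *m invmx L) => X Z eqY.
(* [inord] sends indices above [n] to 0, hence the bounds on [i] below. *)
pose e i : 'rV[F]_n.+1 := delta_mx 0 (inord i).
have eN i : (i < n)%N -> e i *m N = e i.+1.
  move=> i_lt_n; rewrite -rowE; apply/rowP=> j; rewrite !mxE eqxx /= -val_eqE.
  by rewrite /= !inordK // ltnS // ltnW.
have enN : e n *m N = 0.
  rewrite -rowE; apply/rowP=> j; rewrite !mxE inordK //.
  by rewrite ltn_eqF ?ltn_ord.
have eB i : (r <= i <= n)%N -> e i *m invmx L *m B = 0.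
  move=> /andP[r_le_i i_le_n].
  rewrite -[B]mulmx_ebase -/L -/r !mulmxA mulmxKV // -rowE.
  rewrite [row _ _](_ : _ = 0) ?mul0mx //; apply/rowP=> j.
  by rewrite !mxE inordK // [(i < r)%N]ltnNge r_le_i andbF.
have eX i : (r <= i <= n)%N -> e i *m invmx L *m X ^+ k = e i *m N *m invmx L.
  move=> i_bounds; have /(congr1 (mulmx (e i *m invmx L))) := eqY.
  by rewrite mulmxDr -mulmxE mulmxA eB // mul0mx addr0 !mulmxA mulmxKV.
have eXn j : (r + j <= n)%N -> e r *m invmx L *m X ^+ (k * j) = e (r + j)%N *m invmx L.
  elim: j => [|j IHj] lt_n; first by rewrite muln0 expr0 mulmx1 addn0.
  rewrite addnS in lt_n *.
  by rewrite mulnS addnC exprD mulmxA IHj ?(ltnW lt_n) // eX ?leq_addr ?eN // ltnW.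
(* [X ^+ (k * (n - r))] carries [e r L^-1] to [e n L^-1], which is nonzero; [k] more factors [X]
   kill it. *)
have : (k * (n - r) < n.+1)%N.
  apply: (@mulmx_exp_eq0_order_lt _ _ _ k X (e r *m invmx L)).
    rewrite eXn ?subnKC //; apply/eqP=> /(congr1 (mulmx^~ L)).
    rewrite mulmxKV // mul0mx => /rowP/(_ (inord n))/eqP.
    by rewrite !mxE !eqxx oner_eq0.
  by rewrite exprD mulmxA eXn ?subnKC // eX ?r_le_n ?leqnn // enN mul0mx.
by rewrite ltnS leqNgt n_lt.
Qed.

Theorem theorem1p2 (F : closedFieldType) (n k : nat) (A1 A2 : 'M[F]_n)
    (char0 : [pchar F] =i pred0) (n_ge1 : (1 <= n)%N) (k_ge2 : (2 <= k)%N)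
    (A1_unit : A1 \in unitmx) :
  ((nullity A2 <= 1)%N -> surjective (omega k A1 A2)) /\
  (n%:Z <= k%:Z * ((nullity A2)%:Z - 1) -> ~ surjective (omega k A1 A2)).
Proof.
case: n => [//|n] in A1 A2 n_ge1 A1_unit *.
have k_gt0 : (0 < k)%N := ltnW k_ge2.
(* Factoring out [A1] reduces both claims to the coefficients [1] and [A1^-1 * A2]. *)
have rankB : \rank (A1^-1 * A2)%R = \rank A2.
  by rewrite -[_ * _]/(_ *m _) eqmxMfull // row_full_unit unitmx_inv.
have omegaE X Z : A1 * (X ^+ k + A1^-1 * A2 * Z ^+ k) = omega k A1 A2 (X, Z).
  by rewrite mulrDr !mulrA mulrV // mul1r.
rewrite /nullity mxrank_coker; split=> [null_le1 Y|null_large surj].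
  have [|X [Z XZ]] := @solvable_of_corank_le1 F n k (A1^-1 * A2) (A1^-1 * Y) char0 k_gt0.
    by rewrite rankB; lia.
  by exists (X, Z); rewrite -omegaE XZ mulrA mulrV // mul1r.
(* The nullity is [n.+1 - \rank A2], and [null_large] forces it to be positive, so subtracting one
   gives exactly [n - \rank A2], without truncation. *)
have [|Y noY] := @unsolvable_of_large_corank F n k (A1^-1 * A2).
  rewrite rankB; nia.
have [[X Z] XZ] := surj (A1 * Y).
apply: (noY X Z); apply: (mulrI (A1_unit : A1 \is a GRing.unit)).
by rewrite omegaE.
Qed.
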